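(* Let $X$ be a set, let $(A_n)_{n\in\mathbb{N}}$ be a sequence of subsets of $X$, and let $\mathcal{E}$ be an eventual family of subsets of $\mathbb{N}$. Suppose that $\mathcal{E}$ is finitely-insensitive and is not trivial, i.e. $\mathcal{E}$ is neither empty nor the family of all subsets of $\mathbb{N}$. If the classical limit $\lim_{n\to\infty}A_n$ exists, then $$\mathcal{E}\text{-}\lim_{n\to\infty}A_n=\lim_{n\to\infty}A_n .$$
   Context: $\mathbb{N}$ denotes the positive integers. A family $\mathcal{E}$ of subsets of $\mathbb{N}$ is called an eventual family if $S\in\mathcal{E}$ and $S\subseteq S'\subseteq\mathbb{N}$ imply $S'\in\mathcal{E}$. It is called finitely-insensitive if for every $S\in\mathcal{E}$, every set $S'\subseteq\mathbb{N}$ obtained from $S$ by adding and/or deleting finitely many elements also belongs to $\mathcal{E}$. The $\mathcal{E}$-limit of a sequence $(A_n)_{n\in\mathbb{N}}$ of subsets of $X$ is $$\mathcal{E}\text{-}\lim_{n\to\infty}A_n:=\{x\in X\mid \{n\in\mathbb{N}\mid x\in A_n\}\in\mathcal{E}\}.$$ Classical (purely set-theoretic) limits: $\limsup_{n\to\infty}A_n$ is the set of $x\in X$ such that $x\in A_n$ for infinitely many $n$; $\liminf_{n\to\infty}A_n$ is the set of $x\in X$ such that $x\in A_n$ for all but finitely many $n$. The limit $\lim_{n\to\infty}A_n$ exists when these two sets coincide, and is then equal to their common value. *)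

(* Defs.v *)
From mathcomp Require Import all_boot.
From mathcomp Require Import boolp classical_sets functions cardinality.

Set Implicit Arguments.
Unset Strict Implicit.
Unset Printing Implicit Defensive.

Local Open Scope classical_set_scope.

Definition posnat : Type := {n : nat | (0 < n)%N}.

Definition eventual_family (E : set (set posnat)) : Prop :=
  forall S S' : set posnat, E S -> S `<=` S' -> E S'.

(* [S' `\` S] is the set of added elements, [S `\` S'] that of deleted ones. *)
Definition finitely_insensitive (E : set (set posnat)) : Prop :=
  forall S S' : set posnat,
    E S -> finite_set (S' `\` S) -> finite_set (S `\` S') -> E S'.

Definition nontrivial_family (E : set (set posnat)) : Prop :=
  E <> set0 /\ E <> setT.

Definition E_lim (E : set (set posnat)) (X : Type) (A : posnat -> set X) :
    set X :=
  [set x | E [set n | A n x]].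

Definition set_limsup (X : Type) (A : posnat -> set X) : set X :=
  [set x | infinite_set [set n | A n x]].

Definition set_liminf (X : Type) (A : posnat -> set X) : set X :=
  [set x | cofinite_set [set n | A n x]].

(* "The limit of [A] exists and is equal to [L]"; existence of the limit is
   [exists L, is_set_lim A L], and such an [L] is unique. *)
Definition is_set_lim (X : Type) (A : posnat -> set X) (L : set X) : Prop :=
  set_limsup A = L /\ set_liminf A = L.

(* Main.v *)
(** An eventual, finitely-insensitive, nontrivial family contains every cofinite
    set and no finite set. If [x] lies in the limit then [{n | x \in A_n}] is
    cofinite; otherwise it is not infinite, i.e. it is finite. *)
Require Import Defs.
From mathcomp Require Import all_boot.
From mathcomp Require Import boolp classical_sets functions cardinality.

Local Open Scope classical_set_scope.

(** Any member of [E] forces [setT] into [E] by upward closure; deleting the finite complement of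
    [S] from [setT] then leaves [S]. *)
Lemma cofinite_in_family (E : set (set posnat)) (S : set posnat) :
  eventual_family E -> finitely_insensitive E -> E <> set0 ->
  cofinite_set S -> E S.
Proof.
move=> hE hfin /eqP/set0P[S0 ES0] cofS.
apply: (hfin setT); first exact: hE ES0 (@subsetT _ _).
  by rewrite setDT; exact: finite_set0.
by rewrite setTD.
Qed.

(** Deleting all of a finite member would put [set0] in [E], and upward closure would then make [E]
    the full family. *)
Lemma finite_notin_family (E : set (set posnat)) (S : set posnat) :
  eventual_family E -> finitely_insensitive E -> E <> setT ->
  finite_set S -> ~ E S.
Proof.
move=> hE hfin EneqT finS ES; apply: EneqT; rewrite -subTset => S' _.
apply: hE (@sub0set _ S'); apply: (hfin S) => //.
  by rewrite set0D; exact: finite_set0.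
by rewrite setD0.
Qed.

Theorem theorem14 (X : Type) (A : posnat -> set X) (E : set (set posnat))
    (hE : eventual_family E) (hfin : finitely_insensitive E)
    (hnt : nontrivial_family E) (L : set X) (hL : is_set_lim A L) :
  E_lim E A = L.
Proof.
have [Eneq0 EneqT] := hnt; have [limsupL liminfL] := hL.
apply/seteqP; split=> x.
  (* [infinite_set] is a negation, so [finx] assumes finiteness and [False] remains to be shown. *)
  move=> Ex; rewrite -limsupL => finx.
  exact: (finite_notin_family _ _ hE hfin EneqT finx Ex).
by rewrite -liminfL => cofx; exact: (cofinite_in_family _ _ hE hfin Eneq0 cofx).
Qed.
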